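(* Let $\mathbf{R}=\{R_i\}_{i\ge0}$ be a perfectoid tower arising from a pair $(R,I_0)$, and let $\mathbf{R}^\flat=\{R_i^{s.\flat}\}_{i\ge0}$ denote its tilt. Assume that $R_i$ is a Noetherian local ring for every $i\ge0$. Then all layers of $\mathbf{R}$ and $\mathbf{R}^\flat$ have the same Krull dimension: $\dim R_i=\dim R=\dim R_j^{s.\flat}$ for all $i,j\ge0$.
   Context: All rings are commutative and unital. $p$ is a fixed prime. A pair $(A,I)$ is a ring $A$ with an ideal $I$. A tower of rings is an inductive system of rings $\mathbf{R}=\{R_i,t_i\colon R_i\to R_{i+1}\}_{i\ge0}$ indexed by $\mathbb{N}$. For a ring $A$, an ideal $I\subset A$ and an $A$-module $M$, an element $x\in M$ is $I$-torsion if for every $a\in I$ there is $n>0$ with $a^nx=0$; $M_{I\text{-tor}}$ is the submodule of $I$-torsion elements. Let $\varphi_{I,M}\colon M_{I\text{-tor}}\hookrightarrow M\twoheadrightarrow M/IM$ be the natural composite. A ring $A$ is $I$-adically Zariskian if $1+I\subset A^\times$ (equivalently, $I$ is contained in the Jacobson radical of $A$). $\varphi$ denotes the absolute Frobenius $x\mapsto x^p$ of an $\mathbb{F}_p$-algebra. Let $(R,I_0)$ be a pair and $\mathbf{R}=\{R_i,t_i\}_{i\ge0}$ a tower of rings. $\mathbf{R}$ is a perfectoid tower arising from $(R,I_0)$ if: (a) $R_0=R$ and $p\in I_0$. (b) For every $i\ge0$, the ring homomorphism $\overline{t_i}\colon R_i/I_0R_i\to R_{i+1}/I_0R_{i+1}$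 induced by $t_i$ is injective. (c) For every $i\ge0$, $\mathrm{Im}(\varphi_{R_{i+1}/I_0R_{i+1}})\subset\mathrm{Im}(\overline{t_i})$. (Given (a)–(c), there is a unique ring homomorphism $F_i\colon R_{i+1}/I_0R_{i+1}\to R_i/I_0R_i$ with $\overline{t_i}\circ F_i=\varphi$, called the $i$-th Frobenius projection.) (d) For every $i\ge0$, $F_i$ is surjective. (e) For every $i\ge0$, $R_i$ is $I_0R_i$-adically Zariskian. (f) $I_0$ is principal, and $R_1$ contains a principal ideal $I_1$ such that $I_1^p=I_0R_1$ and, for every $i\ge0$, $\mathrm{Ker}(F_i)=I_1(R_{i+1}/I_0R_{i+1})$. (g) For every $i\ge0$, $I_0(R_i)_{I_0\text{-tor}}=(0)$, and there exists a bijection $(F_i)_{\mathrm{tor}}\colon(R_{i+1})_{I_0\text{-tor}}\to(R_i)_{I_0\text{-tor}}$ such that $F_i\circ\varphi_{I_0,R_{i+1}}=\varphi_{I_0,R_i}\circ(F_i)_{\mathrm{tor}}$. Tilt: for $i\ge0$ the $i$-th small tilt is $$R_i^{s.\flat}=\varprojlim(\cdots\xrightarrow{F_{i+1}}R_{i+1}/I_0R_{i+1}\xrightarrow{F_i}R_i/I_0R_i),$$ whose $m$-th projection is the map to $R_{i+m}/I_0R_{i+m}$. The map $t_i^{s.\flat}\colon R_i^{s.\flat}\to R_{i+1}^{s.\flat}$ is the unique ring homomorphism compatible, under the $m$-th projections, with $\overline{t_{i+m}}$ for all $m\ge0$. The tilt is the tower $\mathbf{R}^\flat=\{R_i^{s.\flat},t_i^{s.\flat}\}_{i\ge0}$.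 *)

(* Defs.v *)
From HB Require Import structures.
From mathcomp Require Import all_boot all_order all_algebra.
From mathcomp Require Import boolp classical_sets functions constructive_ereal.

Set Implicit Arguments.
Unset Strict Implicit.
Unset Printing Implicit Defensive.

Import Order.TTheory GRing.Theory Num.Theory.

Local Open Scope classical_set_scope.
Local Open Scope ring_scope.
Local Open Scope quotient_scope.

(* Rings are [comPzRingType]s: commutative and unital, the zero ring allowed.
   MathComp's [idealr] structures are over nonzero rings and only cover proper
   ideals, so ideals are redefined here as sets, improper ones included. *)

Record ideal (A : comPzRingType) := Ideal {
  ideal_set :> set A;
  ideal0 : ideal_set 0;
  idealD : forall x y, ideal_set x -> ideal_set y -> ideal_set (x + y);
  idealM : forall a x, ideal_set x -> ideal_set (a * x) }.

(* Makes [I x] parse as membership for an ideal [I]. *)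
Identity Coercion set_to_fun : set >-> Funclass.

Section IdealTheory.
Variable A : comPzRingType.
Implicit Types (I J : ideal A) (S : set A).

Definition ideal_gen_set S : set A :=
  \bigcap_(J in [set J : ideal A | S `<=` J]) (J : set A).

Lemma ideal_gen0 S : ideal_gen_set S 0.
Proof. by move=> J _; apply: ideal0. Qed.

Lemma ideal_genD S x y :
  ideal_gen_set S x -> ideal_gen_set S y -> ideal_gen_set S (x + y).
Proof. by move=> Sx Sy J SJ; apply: idealD; [apply: Sx | apply: Sy]. Qed.

Lemma ideal_genM S a x : ideal_gen_set S x -> ideal_gen_set S (a * x).
Proof. by move=> Sx J SJ; apply/idealM/Sx. Qed.

Definition ideal_gen S : ideal A :=
  Ideal (@ideal_gen0 S) (@ideal_genD S) (@ideal_genM S).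

Lemma sub_ideal_gen S : S `<=` ideal_gen S.
Proof. by move=> x Sx J SJ; apply: (SJ x). Qed.

Lemma ideal_gen_sub S J : S `<=` J -> ideal_gen S `<=` J.
Proof. by move=> SJ x Sx; apply: (Sx J). Qed.

Definition ideal_mul S1 S2 : ideal A :=
  ideal_gen [set a * b | a in S1 & b in S2].

Definition ideal_exp I n : ideal A :=
  iter n (fun J : ideal A => ideal_mul I J) (ideal_gen [set: A]).

Definition principal I : Prop := exists a, I = ideal_gen [set a] :> set A.

Definition prime_ideal I : Prop :=
  ~ I 1 /\ forall x y, I (x * y) -> I x \/ I y.

Definition maximal_ideal I : Prop :=
  ~ I 1 /\ forall J, ~ J 1 -> I `<=` J -> J = I :> set A.

Definition zariskian I : Prop :=
  forall x, I x -> exists y, (1 + x) * y = 1.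

End IdealTheory.

Definition noetherian (A : comPzRingType) : Prop :=
  forall I : ideal A, exists s : seq A, I = ideal_gen [set` s] :> set A.

Definition local_ring (A : comPzRingType) : Prop :=
  exists2 M : ideal A, maximal_ideal M &
    forall N : ideal A, maximal_ideal N -> N = M :> set A.

Definition prime_chain (A : comPzRingType) (n : nat) (P : nat -> ideal A) :=
  (forall k, (k <= n)%N -> prime_ideal (P k)) /\
  (forall k, (k < n)%N -> P k `<` P k.+1).

(* The value is -oo for the zero ring and +oo when chains of prime ideals have
   unbounded length; in \bar int every set has a supremum. *)
Definition krull_dim (A : comPzRingType) : \bar int :=
  supremum -oo%E [set (n%:Z%:E)%E | n in [set n | exists P : nat -> ideal A,
                                            prime_chain n P]].

Section Quotient.
Variables (A : comPzRingType) (I : ideal A).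

Definition ideal_mem : {pred A} := fun x => `[< I x >].

Lemma ideal_memP x : reflect (I x) (x \in ideal_mem).
Proof. exact: asboolP. Qed.

Lemma ideal_mem_zmod_closed : zmod_closed ideal_mem.
Proof.
split=> [|x y /ideal_memP Ix /ideal_memP Iy]; apply/ideal_memP.
  exact: ideal0.
by apply: idealD => //; rewrite -mulN1r; apply: idealM.
Qed.
HB.instance Definition _ := GRing.isZmodClosed.Build A ideal_mem
  ideal_mem_zmod_closed.

Definition quot_ring : Type := Quotient.quot ideal_mem.
HB.instance Definition _ := GRing.Zmodule.on quot_ring.

Definition quot_pi (x : A) : quot_ring := \pi_(Quotient.quot ideal_mem) x.

Lemma quot_piP x y : quot_pi x = quot_pi y <-> I (x - y).
Proof.
split=> [/eqP|Ixy]; last apply/eqP; rewrite -Quotient.idealrBE.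
  by move/ideal_memP.
exact/ideal_memP.
Qed.

Lemma quot_reprK : cancel (fun q : quot_ring => repr q) quot_pi.
Proof. exact: reprK. Qed.

Lemma quot_piB : zmod_morphism quot_pi.
Proof. by move=> x y; rewrite /quot_pi raddfB. Qed.
HB.instance Definition _ :=
  GRing.isZmodMorphism.Build A quot_ring quot_pi quot_piB.

Definition quot_mul (x y : quot_ring) : quot_ring := quot_pi (repr x * repr y).

Lemma quot_piM x y : quot_mul (quot_pi x) (quot_pi y) = quot_pi (x * y).
Proof.
apply/quot_piP; set x' := repr _; set y' := repr _.
have Ix : I (x' - x) by apply/quot_piP; rewrite quot_reprK.
have Iy : I (y' - y) by apply/quot_piP; rewrite quot_reprK.
have -> : x' * y' - x * y = x' * (y' - y) + y * (x' - x).
  by rewrite !mulrBr [y * x']mulrC [y * x]mulrC addrA subrK.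
by apply: idealD; apply: idealM.
Qed.

Lemma quot_mulA : associative quot_mul.
Proof.
move=> x y z; rewrite -[x]quot_reprK -[y]quot_reprK -[z]quot_reprK.
by rewrite !quot_piM mulrA.
Qed.

Lemma quot_mulC : commutative quot_mul.
Proof. by move=> x y; rewrite /quot_mul mulrC. Qed.

Lemma quot_mul1 : left_id (quot_pi 1) quot_mul.
Proof. by move=> x; rewrite -[x]quot_reprK quot_piM mul1r. Qed.

Lemma quot_mulDl : left_distributive quot_mul +%R.
Proof.
move=> x y z; rewrite -[x]quot_reprK -[y]quot_reprK -[z]quot_reprK.
by rewrite -raddfD !quot_piM mulrDl raddfD.
Qed.

HB.instance Definition _ := GRing.Zmodule_isComPzRing.Build quot_ring
  quot_mulA quot_mulC quot_mul1 quot_mulDl.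

Lemma quot_pi_monoid : monoid_morphism quot_pi.
Proof. by split=> // x y; rewrite -quot_piM. Qed.
HB.instance Definition _ :=
  GRing.isMonoidMorphism.Build A quot_ring quot_pi quot_pi_monoid.

End Quotient.

Section QuotientMap.
Variables (A B : comPzRingType) (f : {rmorphism A -> B}).
Variables (I : ideal A) (J : ideal B).
Hypothesis fIJ : f @` I `<=` J.

Definition quot_map of f @` I `<=` J : quot_ring I -> quot_ring J :=
  fun q => quot_pi J (f (repr q)).
Local Notation g := (quot_map fIJ).

Lemma quot_mapE x : g (quot_pi I x) = quot_pi J (f x).
Proof.
apply/quot_piP; rewrite -raddfB; apply: fIJ; exists (repr (quot_pi I x) - x) => //.
by apply/quot_piP; rewrite quot_reprK.
Qed.

Lemma quot_mapB : zmod_morphism g.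
Proof.
move=> x y; rewrite -[x]quot_reprK -[y]quot_reprK.
by rewrite -raddfB !quot_mapE -raddfB -raddfB.
Qed.

Lemma quot_map_monoid : monoid_morphism g.
Proof.
split=> [|x y]; first by rewrite -(rmorph1 (quot_pi I)) quot_mapE !rmorph1.
rewrite -[x]quot_reprK -[y]quot_reprK.
by rewrite -rmorphM !quot_mapE !rmorphM.
Qed.

HB.instance Definition _ := GRing.isZmodMorphism.Build _ _ g quot_mapB.
HB.instance Definition _ := GRing.isMonoidMorphism.Build _ _ g quot_map_monoid.
End QuotientMap.

Section InverseLimit.
Variables (Q : nat -> comPzRingType) (F : forall m, {rmorphism Q m.+1 -> Q m}).

Record ring_lim := RingLim {
  lim_proj : forall m, Q m;
  lim_projP : forall m, F m (lim_proj m.+1) = lim_proj m }.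

HB.instance Definition _ := gen_eqMixin ring_lim.
HB.instance Definition _ := gen_choiceMixin ring_lim.

Lemma ring_lim_eq (x y : ring_lim) :
  (forall m, lim_proj x m = lim_proj y m) -> x = y.
Proof.
case: x y => [x xP] [y yP] /= xy.
have {}xy : x = y by apply: functional_extensionality_dep.
by subst y; congr RingLim; apply: Prop_irrelevance.
Qed.

Definition lim_zero : ring_lim.
Proof. by exists (fun=> 0) => m; rewrite raddf0. Defined.

Definition lim_one : ring_lim.
Proof. by exists (fun=> 1) => m; rewrite rmorph1. Defined.

Definition lim_opp (x : ring_lim) : ring_lim.
Proof.
by exists (fun m => - lim_proj x m) => m; rewrite rmorphN lim_projP.
Defined.

Definition lim_add (x y : ring_lim) : ring_lim.
Proof.
by exists (fun m => lim_proj x m + lim_proj y m) => m; rewrite rmorphD !lim_projP.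
Defined.

Definition lim_mul (x y : ring_lim) : ring_lim.
Proof.
by exists (fun m => lim_proj x m * lim_proj y m) => m; rewrite rmorphM !lim_projP.
Defined.

Lemma lim_addA : associative lim_add.
Proof. by move=> x y z; apply: ring_lim_eq => m; apply: addrA. Qed.
Lemma lim_addC : commutative lim_add.
Proof. by move=> x y; apply: ring_lim_eq => m; apply: addrC. Qed.
Lemma lim_add0 : left_id lim_zero lim_add.
Proof. by move=> x; apply: ring_lim_eq => m; apply: add0r. Qed.
Lemma lim_addN : left_inverse lim_zero lim_opp lim_add.
Proof. by move=> x; apply: ring_lim_eq => m; apply: addNr. Qed.
HB.instance Definition _ := GRing.isZmodule.Build ring_lim
  lim_addA lim_addC lim_add0 lim_addN.

Lemma lim_mulA : associative lim_mul.
Proof. by move=> x y z; apply: ring_lim_eq => m; apply: mulrA. Qed.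
Lemma lim_mulC : commutative lim_mul.
Proof. by move=> x y; apply: ring_lim_eq => m; apply: mulrC. Qed.
Lemma lim_mul1 : left_id lim_one lim_mul.
Proof. by move=> x; apply: ring_lim_eq => m; apply: mul1r. Qed.
Lemma lim_mulDl : left_distributive lim_mul +%R.
Proof. by move=> x y z; apply: ring_lim_eq => m; apply: mulrDl. Qed.
HB.instance Definition _ := GRing.Zmodule_isComPzRing.Build ring_lim
  lim_mulA lim_mulC lim_mul1 lim_mulDl.

End InverseLimit.

Section InverseLimitMap.
Variables (Q Q' : nat -> comPzRingType).
Variables (F : forall m, {rmorphism Q m.+1 -> Q m}).
Variables (F' : forall m, {rmorphism Q' m.+1 -> Q' m}).
Variable g : forall m, {rmorphism Q m -> Q' m}.
Hypothesis gF : forall m x, F' m (g m.+1 x) = g m (F m x).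

Definition lim_map (gF' : forall m x, F' m (g m.+1 x) = g m (F m x)) :
  ring_lim F -> ring_lim F'.
Proof.
by move=> x; exists (fun m => g m (lim_proj x m)) => m; rewrite gF' lim_projP.
Defined.

Lemma lim_mapB : zmod_morphism (lim_map gF).
Proof. by move=> x y; apply: ring_lim_eq => m; apply: raddfB. Qed.
Lemma lim_map_monoid : monoid_morphism (lim_map gF).
Proof.
by split=> [|x y]; apply: ring_lim_eq => m; [apply: rmorph1 | apply: rmorphM].
Qed.
HB.instance Definition _ := GRing.isZmodMorphism.Build _ _ (lim_map gF) lim_mapB.
HB.instance Definition _ :=
  GRing.isMonoidMorphism.Build _ _ (lim_map gF) lim_map_monoid.
End InverseLimitMap.

Lemma exprD_prime (A : comPzRingType) p (x y : A) :
  prime p -> (p%:R : A) = 0 -> (x + y) ^+ p = x ^+ p + y ^+ p.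
Proof.
case: p => // p pr p0; rewrite exprDn big_ord_recl big_ord_recr /=.
rewrite subn0 subnn expr0 mulr1 mul1r bin0 binn !mulr1n big1 ?add0r // => i _.
have /dvdnP[k ->] : (p.+1 %| 'C(p.+1, bump 0 i))%N.
  by apply: prime_dvd_bin => //; rewrite /bump /= add1n ltnS.
by rewrite -mulr_natr natrM p0 !mulr0.
Qed.

Record tower := Tower {
  layer :> nat -> comPzRingType;
  trans : forall i, {rmorphism layer i -> layer i.+1} }.

Definition tower_shift (T : tower) : tower :=
  @Tower (fun i => T i.+1) (fun i => trans T i.+1).

Fixpoint tower_map (T : tower) (i : nat) : {rmorphism T 0%N -> T i} :=
  match i with
  | 0%N => idfun
  | j.+1 => trans T j \o tower_map T j
  end.

Section PerfectoidTower.
Variables (p : nat) (p_prime : prime p).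
(* The pair (R, I_0) is (T 0, I0). *)
Variables (T : tower) (I0 : ideal (T 0%N)).

(* I_0 R_i *)
Definition ext_I0 i : ideal (T i) := ideal_gen (tower_map T i @` I0).

(* R_i / I_0 R_i *)
Definition redlayer i : comPzRingType := quot_ring (ext_I0 i).

Lemma trans_ext_I0 i : trans T i @` ext_I0 i `<=` ext_I0 i.+1.
Proof.
pose t := trans T i; have K0 : ext_I0 i.+1 (t 0) by rewrite raddf0; apply: ideal0.
have KD x y : ext_I0 i.+1 (t x) -> ext_I0 i.+1 (t y) -> ext_I0 i.+1 (t (x + y)).
  by rewrite raddfD; apply: idealD.
have KM a x : ext_I0 i.+1 (t x) -> ext_I0 i.+1 (t (a * x)).
  by rewrite rmorphM; apply: idealM.
move=> _ [x xI <-]; apply: (xI (Ideal K0 KD KM)) => _ [a aI <-] /=.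
by apply: sub_ideal_gen; exists a.
Qed.

(* \overline{t_i} *)
Definition redtrans i : {rmorphism redlayer i -> redlayer i.+1} :=
  quot_map (@trans_ext_I0 i).

Record purely_inseparable_tower : Prop := {
  p_in_I0 : I0 p%:R;
  redtrans_inj : forall i, injective (redtrans i);
  frobenius_sub : forall i,
    range (fun x : redlayer i.+1 => x ^+ p) `<=` range (redtrans i) }.

Lemma redlayer_char i :
  purely_inseparable_tower -> (p%:R : redlayer i) = 0.
Proof.
move=> H; rewrite -(rmorph_nat (quot_pi (ext_I0 i))) -(rmorph0 (quot_pi (ext_I0 i))).
apply/quot_piP; rewrite subr0 -(rmorph_nat (tower_map T i)).
by apply: sub_ideal_gen; exists p%:R => //; apply: p_in_I0.
Qed.

Lemma frob_proj_exists i : purely_inseparable_tower ->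
  exists F : {rmorphism redlayer i.+1 -> redlayer i},
    forall x, redtrans i (F x) = x ^+ p.
Proof.
move=> H; have ex x : exists y, redtrans i y = x ^+ p.
  by have [|y _ <-] := @frobenius_sub H i (x ^+ p); [exists x | exists y].
pose f x := sval (cid (ex x)).
have fE x : redtrans i (f x) = x ^+ p by exact: svalP (cid (ex x)).
have fB : zmod_morphism f.
  move=> x y; apply: (redtrans_inj H); rewrite rmorphB !fE; apply/eqP.
  rewrite eq_sym subr_eq -(exprD_prime _ _ p_prime) ?subrK //.
  exact: redlayer_char.
have fM : monoid_morphism f.
  split=> [|x y]; apply: (redtrans_inj H).
    by rewrite fE rmorph1 expr1n.
  by rewrite rmorphM !fE exprMn.
pose fa := GRing.isZmodMorphism.Build _ _ f fB.
pose fm := GRing.isMonoidMorphism.Build _ _ f fM.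
pose F : {rmorphism _ -> _} := HB.pack f fa fm.
by exists F.
Qed.

(* Unique, by injectivity of [redtrans i]. *)
Definition frob_proj (H : purely_inseparable_tower) i :
    {rmorphism redlayer i.+1 -> redlayer i} :=
  sval (cid (frob_proj_exists i H)).

Lemma frob_projE H i x : redtrans i (frob_proj H i x) = x ^+ p.
Proof. exact: svalP (cid (frob_proj_exists i H)) x. Qed.

(* Torsion of R_i as an R-module. *)
Definition I0_torsion i : set (T i) :=
  [set x | forall a, I0 a ->
     exists2 n, (0 < n)%N & tower_map T i a ^+ n * x = 0].
Arguments I0_torsion i _ : clear implicits.

Record perfectoid_tower : Prop := {
  pft_insep : purely_inseparable_tower;
  pft_surj : forall i, range (frob_proj pft_insep i) = [set: redlayer i];
  pft_zariskian : forall i, zariskian (ext_I0 i);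
  pft_principal : principal I0;
  pft_kernel : exists I1 : ideal (T 1%N), [/\ principal I1,
    ideal_exp I1 p = ext_I0 1 :> set (T 1%N) &
    forall i, [set x | frob_proj pft_insep i x = 0] =
      ideal_gen [set quot_pi (ext_I0 i.+1) (tower_map (tower_shift T) i a)
                | a in I1] :> set (redlayer i.+1)];
  (* The ideal product of [ext_I0 i] and the torsion is I_0 (R_i)_{I_0-tor}. *)
  pft_torsion0 : forall i, ideal_mul (ext_I0 i) (I0_torsion i) = [set 0] :> set (T i);
  pft_torsion : forall i, exists Ftor : T i.+1 -> T i,
    set_bij (I0_torsion i.+1) (I0_torsion i) Ftor /\
    (forall x, I0_torsion i.+1 x ->
      frob_proj pft_insep i (quot_pi (ext_I0 i.+1) x) =
      quot_pi (ext_I0 i) (Ftor x)) }.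

Section Tilt.
Variable H : purely_inseparable_tower.

Lemma frob_proj_trans i x :
  frob_proj H i.+1 (redtrans i.+1 x) = redtrans i (frob_proj H i x).
Proof. by apply: (redtrans_inj H); rewrite !frob_projE rmorphXn. Qed.

Definition small_tilt i : comPzRingType :=
  @ring_lim (fun m => redlayer (m + i)) (fun m => frob_proj H (m + i)).

(* The layers indexed by (m + i).+1 and m + i.+1 are only propositionally
   equal, hence the cast in the definition of t_i^{s.\flat}. *)
Definition redlayer_cast j k (e : j = k) : {rmorphism redlayer j -> redlayer k} :=
  match e in _ = k return {rmorphism redlayer j -> redlayer k} with
  | erefl => idfun
  end.

Definition small_tilt_step i m :
    {rmorphism redlayer (m + i) -> redlayer (m + i.+1)} :=
  redlayer_cast (esym (addnS m i)) \o redtrans (m + i).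

Lemma frob_proj_cast j k (e : j = k) (e' : j.+1 = k.+1) x :
  frob_proj H k (redlayer_cast e' x) = redlayer_cast e (frob_proj H j x).
Proof. by case: k / e e' => e'; rewrite (eq_irrelevance e' erefl). Qed.

Lemma small_tilt_stepP i m x :
  frob_proj H (m + i.+1) (small_tilt_step i m.+1 x) =
  small_tilt_step i m (frob_proj H (m + i) x).
Proof.
by rewrite /small_tilt_step /= (frob_proj_cast (esym (addnS m i))) frob_proj_trans.
Qed.

Definition small_tilt_trans i : {rmorphism small_tilt i -> small_tilt i.+1} :=
  lim_map (@small_tilt_stepP i).

Definition tilt : tower := Tower small_tilt_trans.

End Tilt.

End PerfectoidTower.

(* Main.v *)
(* Let f generate I_0 and let T_i be the f-torsion of R_i; it is killed by f, so
   a prime of R_i contains f or T_i, and f is regular modulo T_i. As f lies in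
   the Jacobson radical, Krull's principal ideal theorem gives
     dim R_i = max (dim R_i/f, dim R_i/(T_i + f) + 1),
   which depends only on R_i/f and the image U_i of T_i in it. The Frobenius
   projection F_i is surjective with nil kernel and maps U_{i+1} bijectively onto
   U_i, so the right hand side is independent of i.
   In the tilt B of R_j, an element e whose image in R_{j+1}/f generates Ker F_j
   satisfies B/e = R_j/f, and B is e-adically complete, hence Noetherian; its
   e-torsion is the limit of the U_{j+m}, which maps bijectively onto U_j. So the
   same formula computes dim B. *)
Require Import Defs.
From HB Require Import structures.
From mathcomp Require Import all_boot all_order all_algebra.
From mathcomp Require Import ring.
From mathcomp Require Import boolp classical_sets functions constructive_ereal.

Set Implicit Arguments.
Unset Strict Implicit.
Unset Printing Implicit Defensive.

Import GRing.Theory.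

Local Open Scope classical_set_scope.
Local Open Scope ring_scope.

(** * Ideals and Noetherian rings *)

Section Ideals.
Variable A : comPzRingType.
Implicit Types (I J K M N P Q : ideal A) (S : set A) (s : seq A) (a b x y z : A).

Lemma idealB I x y : I x -> I y -> I (x - y).
Proof.
by move=> Ix Iy; rewrite -mulN1r; apply: idealD => //; apply: idealM.
Qed.

Lemma idealMr I x a : I x -> I (x * a).
Proof. by rewrite mulrC; apply: idealM. Qed.

Lemma ideal_subK I x y : I y -> I (x - y) -> I x.
Proof. by move=> Iy Ixy; rewrite -(subrK y x); apply: idealD. Qed.

Lemma idealX I x n : I x -> (0 < n)%N -> I (x ^+ n).
Proof. by case: n => // n Ix _; rewrite exprS; apply: idealMr. Qed.

Definition zero_ideal : ideal A.
Proof.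
exists [set 0] => // [x y -> ->|a x ->]; by rewrite ?addr0 ?mulr0.
Defined.

Definition unit_ideal : ideal A.
Proof. by exists setT. Defined.

Definition ideal_sum I J : ideal A.
Proof.
exists [set x | exists2 y, I y & J (x - y)].
- by exists 0; rewrite ?subr0; apply: ideal0.
- move=> x y [x' Ix Jx] [y' Iy Jy]; exists (x' + y'); first exact: idealD.
  by rewrite opprD addrACA; apply: idealD.
- move=> a x [x' Ix Jx]; exists (a * x'); first exact: idealM.
  by rewrite -mulrBr; apply: idealM.
Defined.

(** The ideal [I + P z]. Taking [P] to be the unit ideal adjoins [z] itself; Nakayama's lemma needs
    coefficients in a prime [P]. *)
Definition ideal_adjoin I P z : ideal A.
Proof.
exists [set x | exists2 c, P c & I (x - c * z)].
- by exists 0; rewrite ?mul0r ?subr0; apply: ideal0.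
- move=> x y [c Pc Ic] [d Pd Id]; exists (c + d); first exact: idealD.
  by rewrite mulrDl opprD addrACA; apply: idealD.
- move=> a x [c Pc Ic]; exists (a * c); first exact: idealM.
  by rewrite -mulrA -mulrBr; apply: idealM.
Defined.

Definition colon I b : ideal A.
Proof.
exists [set y | I (y * b)].
- by rewrite /= mul0r; apply: ideal0.
- by move=> x y /= Ix Iy; rewrite mulrDl; apply: idealD.
- by move=> a x /= Ix; rewrite -mulrA; apply: idealM.
Defined.

Definition mult_closed S := S 1 /\ forall x y, S x -> S y -> S (x * y).

(** The contraction of the extension of [I] to the localization at [S]. Saturated ideals of [A]
    stand in for ideals of the localization. *)
Definition saturation S (SM : mult_closed S) I : ideal A.
Proof.
exists [set y | exists2 s, S s & I (s * y)].
- by exists 1; [case: SM | rewrite mulr0; apply: ideal0].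
- move=> x y [s Ss Ix] [t St Iy]; exists (s * t); first exact: (proj2 SM).
  have -> : s * t * (x + y) = t * (s * x) + s * (t * y) by ring.
  by apply: idealD; apply: idealM.
- move=> a x [s Ss Ix]; exists s => //.
  by rewrite mulrCA; apply: idealM.
Defined.

Lemma sub_ideal_sumr I J : J `<=` ideal_sum I J.
Proof. by move=> x Jx; exists 0; rewrite ?subr0 //; apply: ideal0. Qed.

Lemma sub_ideal_suml I J : I `<=` ideal_sum I J.
Proof. by move=> x Ix; exists x; rewrite ?subrr //; apply: ideal0. Qed.

Lemma sub_ideal_adjoin I P z : I `<=` ideal_adjoin I P z.
Proof. by move=> x Ix; exists 0; rewrite ?mul0r ?subr0 //; apply: ideal0. Qed.

Lemma mem_ideal_adjoin I z : ideal_adjoin I unit_ideal z z.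
Proof. by exists 1; rewrite ?mul1r ?subrr //; apply: ideal0. Qed.

Lemma sub_saturation S (SM : mult_closed S) I : I `<=` saturation SM I.
Proof. by move=> x Ix; exists 1; rewrite ?mul1r //; case: SM. Qed.

Lemma prime_compl P : prime_ideal P -> mult_closed (~` P).
Proof. by case=> P1 PM; split=> // x y Px Py /PM[]. Qed.

Lemma primeX P x n : prime_ideal P -> P (x ^+ n) -> P x.
Proof.
move=> [P1 PM]; elim: n => [/P1//|n IHn]; rewrite exprS => /PM[]//.
Qed.

Lemma ideal_gen1P a x : ideal_gen [set a] x <-> exists c, x = c * a.
Proof.
split=> [|[c ->]]; last by apply/idealM/sub_ideal_gen.
have H0 : [set x | exists c, x = c * a] 0 by exists 0; rewrite mul0r.
have HD x' y' : [set x | exists c, x = c * a] x' ->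
    [set x | exists c, x = c * a] y' -> [set x | exists c, x = c * a] (x' + y').
  by move=> [c ->] [d ->]; exists (c + d); rewrite mulrDl.
have HM b x' : [set x | exists c, x = c * a] x' ->
    [set x | exists c, x = c * a] (b * x').
  by move=> [c ->]; exists (b * c); rewrite mulrA.
apply: (@ideal_gen_sub _ _ (Ideal H0 HD HM)) => _ ->.
by exists 1; rewrite mul1r.
Qed.

(* [N + \sum_(z <- s) P z] *)
Fixpoint ideal_comb P N s : ideal A :=
  if s is z :: s' then ideal_adjoin (ideal_comb P N s') P z else N.

Definition ideal_span s := ideal_comb unit_ideal zero_ideal s.

Lemma sub_ideal_comb P N s : N `<=` ideal_comb P N s.
Proof.
by elim: s => //= z s IHs x Nx; apply/sub_ideal_adjoin/IHs.
Qed.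

Lemma ideal_comb_mul P N s a x : P a -> ideal_span s x -> ideal_comb P N s (a * x).
Proof.
move=> Pa; elim: s x => [x ->|z s IHs x [c _ sx]] /=.
  by rewrite mulr0; apply: ideal0.
by exists (a * c); [apply: idealMr | rewrite -mulrA -mulrBr; apply: IHs].
Qed.

Lemma mem_ideal_span s z : z \in s -> ideal_span s z.
Proof.
elim: s => // y s IHs; rewrite inE => /predU1P[->|/IHs sz].
  exact: mem_ideal_adjoin.
exact: sub_ideal_adjoin sz.
Qed.

Lemma ideal_span_sub s I : (forall z, z \in s -> I z) -> ideal_span s `<=` I.
Proof.
elim: s => [_ _ ->|y s IHs sI x [c _ sx]]; first exact: ideal0.
apply: (@ideal_subK _ _ (c * y)).
  by apply/idealM/sI; rewrite mem_head.
by apply: (IHs _ _ sx) => z zs; apply: sI; rewrite inE zs orbT.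
Qed.

Lemma ideal_gen_seq s : ideal_gen [set` s] = ideal_span s :> set A.
Proof.
apply/seteqP; split.
  by apply: ideal_gen_sub => z /= zs; apply: mem_ideal_span.
by apply: ideal_span_sub => z zs; apply: sub_ideal_gen.
Qed.

Definition fin_gen I := exists s, I = ideal_span s :> set A.

Lemma noetherianP : noetherian A <-> forall I, fin_gen I.
Proof.
by split=> AN I; have [s Is] := AN I; exists s; rewrite Is ideal_gen_seq.
Qed.

End Ideals.

(** * Maximal condition, primes disjoint from a multiplicative set, Nakayama's lemma *)

Section Noetherian.
Variables (A : comPzRingType) (noethA : noetherian A).
Implicit Types (I J K M N P Q : ideal A) (S : set A) (s : seq A) (a b x y z : A).

(** Otherwise choice produces a strictly ascending sequence in [C]; its union is finitely generated,
    so some term already contains it. *)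
Lemma noetherian_max (C : ideal A -> Prop) I : C I ->
  exists2 M, C M & forall J, C J -> M `<=` J -> J `<=` M.
Proof.
move=> CI; apply: contrapT => noM.
have next J : exists K, C J -> [/\ C K, J `<=` K & ~ (K `<=` J)].
  have [CJ|nCJ] := pselect (C J); last by exists J.
  apply: contrapT => noK; apply: noM; exists J => // K CK JK.
  by apply: contrapT => nKJ; apply: noK; exists K.
have [nx nxP] := choice next.
pose u n := iter n nx I.
have Cu n : C (u n) by elim: n => //= n IHn; have [] := nxP _ IHn.
have us n : u n `<=` u n.+1 by have [] := nxP _ (Cu n).
have umono m n : (m <= n)%N -> u m `<=` u n.
  elim: n => [|n IHn]; first by rewrite leqn0 => /eqP->.
  rewrite leq_eqVlt => /predU1P[->//|]; rewrite ltnS => /IHn umn.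
  exact: subset_trans (us n).
pose U : set A := \bigcup_n u n.
have U0 : U 0 by exists 0%N => //; apply: ideal0.
have UD x y : U x -> U y -> U (x + y).
  move=> [m _ ux] [n _ uy]; exists (maxn m n) => //.
  by apply: idealD; [apply: umono ux|apply: umono uy]; rewrite ?leq_maxl ?leq_maxr.
have UM a x : U x -> U (a * x) by move=> [m _ ux]; exists m => //; apply: idealM.
have [s Us] := (noetherianP A).1 noethA (Ideal U0 UD UM).
have [n sn] : exists n, forall z, z \in s -> u n z.
  have : forall z, z \in s -> U z by move=> z /mem_ideal_span; rewrite -Us.
  elim: s {Us} => [|y s IHs] sU; first by exists 0%N.
  have [|n sn] := IHs; first by move=> z zs; apply: sU; rewrite inE zs orbT.
  have [m _ um] := sU y (mem_head y s).
  exists (maxn m n) => z; rewrite inE => /predU1P[->|/sn].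
    by apply: umono um; rewrite leq_maxl.
  by apply: umono; rewrite leq_maxr.
have [_ _] := nxP _ (Cu n); apply=> x xu.
apply: (ideal_span_sub sn); rewrite -Us; by exists n.+1.
Qed.

Lemma noetherian_ind (C : ideal A -> Prop) :
  (forall I, (forall J, I `<=` J -> ~ (J `<=` I) -> C J) -> C I) ->
  forall I, C I.
Proof.
move=> IH I; apply: contrapT => nCI.
have [M nCM Mmax] := noetherian_max (C := fun J => ~ C J) nCI.
by apply/nCM/IH => J MJ nJM; apply: contrapT => nCJ; apply/nJM/Mmax.
Qed.

(** An ideal [P] maximal among those over [I] missing [S] is prime: if [x] and [y] are outside, then
    [P + (x)] and [P + (y)] meet [S], and the product of the two elements would lie in
    [P + (x * y)]. *)
Lemma prime_avoiding S I : mult_closed S -> I `&` S `<=` set0 ->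
  exists P, [/\ prime_ideal P, I `<=` P & P `&` S `<=` set0].
Proof.
move=> [S1 SM] IS.
have [|P [IP PS] Pmax] := noetherian_max
  (C := fun J => I `<=` J /\ J `&` S `<=` set0) (I := I); first by split.
have meetS x : ~ P x -> exists2 s, S s & ideal_adjoin P (unit_ideal A) x s.
  move=> nPx; apply: contrapT => nos; apply: nPx.
  apply: (Pmax (ideal_adjoin P (unit_ideal A) x)); last exact: mem_ideal_adjoin.
    split; first by apply: (subset_trans IP); apply: sub_ideal_adjoin.
    by move=> s [Ps Ss]; apply: nos; exists s.
  exact: sub_ideal_adjoin.
exists P; split=> //; split; first by move=> P1; apply: (PS 1).
move=> x y Pxy; apply: contrapT.
move=> /not_orP[/meetS[s Ss [c _ Pc]] /meetS[t St [d _ Pd]]].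
apply: (PS (s * t)); split; last exact: SM.
have -> : s * t = t * (s - c * x) + c * x * (t - d * y) + c * d * (x * y) by ring.
by apply: idealD; [apply: idealD|]; apply: idealM.
Qed.

Lemma exists_prime_above I : ~ I 1 -> exists2 P, prime_ideal P & I `<=` P.
Proof.
move=> I1; have [|x [Ix x1]|P [Pp IP _]] := @prime_avoiding [set 1] I.
- by split=> // x y -> ->; rewrite mulr1.
- by apply: I1; rewrite -x1.
- by exists P.
Qed.

(** The localization at [P] is expressed by denominators [u] outside [P]. Generators of [M] are
    eliminated one at a time. *)
Lemma nakayama P M N : prime_ideal P ->
  (forall z, M z -> exists2 u, ~ P u & ideal_sum N (ideal_mul P M) (u * z)) ->
  forall z, M z -> exists2 u, ~ P u & N (u * z).
Proof.
move=> Pp MP; have [P1 PM] := Pp; have [s Ms] := (noetherianP A).1 noethA M.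
have {MP} : forall z, z \in s -> exists2 u, ~ P u & ideal_comb P N s (u * z).
  move=> z /mem_ideal_span; rewrite -Ms => /MP[u Pu [w Nw PMw]]; exists u => //.
  apply: (@ideal_subK _ _ _ w); first exact: sub_ideal_comb.
  apply: ideal_gen_sub PMw => _ [a Pa [b Mb <-]].
  by apply: ideal_comb_mul => //; rewrite -Ms.
suff sN : (forall z, z \in s -> exists2 u, ~ P u & ideal_comb P N s (u * z)) ->
    forall z, z \in s -> saturation (prime_compl Pp) N z.
  by move=> /sN {}sN z; rewrite Ms => /(ideal_span_sub sN).
elim: {Ms} s => //= y s IHs sP.
have [u Pu [c Pc uy]] := sP y (mem_head y s).
(* Since [c] is in [P] and [u] is not, [v] is invertible at [P]; so [y] is locally a combination of
   the remaining generators. *)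
pose v := u - c.
have nPv : ~ P v by move=> Pv; apply/Pu/(ideal_subK Pc Pv).
have vy : ideal_comb P N s (v * y) by rewrite mulrBl.
have sN z : z \in s -> saturation (prime_compl Pp) N z.
  apply: IHs => {}z zs; have [|w Pw [d Pd wz]] := sP z; first by rewrite inE zs orbT.
  exists (v * w); first by case/PM.
  have -> : v * w * z = v * (w * z - d * y) + d * (v * y) by ring.
  by apply: idealD; apply: idealM.
have combN : ideal_comb P N s `<=` saturation (prime_compl Pp) N.
  elim: s sN {IHs sP uy vy} => [_|x s IHs sN]; first exact: sub_saturation.
  move=> z [d _ xz]; apply: (@ideal_subK _ _ _ (d * x)).
    by apply/idealM/sN; rewrite mem_head.
  by apply: IHs xz => t ts; apply: sN; rewrite inE ts orbT.
move=> z; rewrite inE => /predU1P[->|/sN//].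
have [w Pw Nw] := combN _ vy; exists (w * v); first by case/PM.
by rewrite -mulrA.
Qed.

End Noetherian.

(** * The principal ideal theorem and chains of primes *)

Section PrincipalIdealTheorem.
Variables (A : comPzRingType) (noethA : noetherian A).
Implicit Types (I K L P Q : ideal A) (S : set A) (a b x y z : A).

Definition saturated P I : Prop := forall s z, ~ P s -> I (s * z) -> I z.

Lemma saturation_saturated P (Pp : prime_ideal P) I :
  saturated P (saturation (prime_compl Pp) I).
Proof.
move=> s z Ps [t Pt Itsz]; exists (t * s); first by case/(proj2 Pp).
by rewrite -mulrA.
Qed.

(* [b] generates a simple submodule of [A / I] localized at [P]: the ideals
   [colon I b], [b] not in [I], that are maximal are prime. *)
Lemma exists_simple_colon P I : saturated P I -> ~ I 1 ->
  (forall Q, prime_ideal Q -> I `<=` Q -> Q `<=` P -> P `<=` Q) ->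
  exists2 b, ~ I b & P `<=` colon I b.
Proof.
move=> satI I1 minP.
have [|_ [b Ib ->] bmax] := noetherian_max noethA
  (C := fun J => exists2 b, ~ I b & J = colon I b) (I := colon I 1).
  by exists 1.
exists b => //; apply: minP => [|x Ix|s Isb].
- split=> [|x y]; rewrite /= ?mul1r //.
  move=> Ixyb; apply: contrapT => /not_orP[Ixb Iyb]; apply: Ixb.
  have : colon I (y * b) x by rewrite /= mulrA.
  apply: bmax => [|z /= Izb]; first by exists (y * b).
  by rewrite mulrCA; apply: idealM.
- by rewrite /= mulrC; apply: idealM.
- by apply: contrapT => Ps; apply/Ib/(satI _ _ Ps Isb).
Qed.

(** This is the Artinian property of [A / I] localized at a minimal prime [P] over [I]. By
    Noetherian induction on [K], the chain becomes stationary once a [b] spanning a simple submodule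
    modulo [K] is adjoined, and [b] itself can leave the chain only once. *)
Lemma saturated_dcc P I (J : nat -> ideal A) :
  prime_ideal P ->
  (forall Q, prime_ideal Q -> I `<=` Q -> Q `<=` P -> P `<=` Q) ->
  (forall n, saturated P (J n)) -> (forall n, J n.+1 `<=` J n) ->
  (forall n, I `<=` J n) ->
  exists N, forall n, (N <= n)%N -> J n `<=` J n.+1.
Proof.
move=> Pp minP satJ decJ IJ; have [P1 PM] := Pp.
pose C K := saturated P K -> I `<=` K -> forall J : nat -> ideal A,
  (forall n, saturated P (J n)) -> (forall n, J n.+1 `<=` J n) ->
  (forall n, K `<=` J n) -> exists N, forall n, (N <= n)%N -> J n `<=` J n.+1.
suff CK : forall K, C K.
  apply: (CK (saturation (prime_compl Pp) I)) => //.
  - exact: saturation_saturated.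
  - exact: sub_saturation.
  - by move=> n z [s Ps /IJ/(satJ n _ _ Ps)].
apply: (noetherian_ind noethA) => K IH satK IK {}J {}satJ {}decJ KJ {IJ}.
have [K1|K1] := pselect (K 1).
  by exists 0%N => n _ z _; rewrite -[z]mulr1; apply/idealM/KJ.
have [|b Kb Pb] := exists_simple_colon satK K1.
  by move=> Q Qp KQ; apply: minP => //; apply: subset_trans KQ.
pose add K := saturation (prime_compl Pp) (ideal_adjoin K (unit_ideal A) b).
have subadd L : L `<=` add L.
  by apply: subset_trans (@sub_saturation _ _ _ _); apply: sub_ideal_adjoin.
have addP L : add L b by apply/sub_saturation/mem_ideal_adjoin.
have addS L (L' : ideal A) : L `<=` L' -> add L `<=` add L'.
  by move=> LL' z [s Ps [c _ Lc]]; exists s => //; exists c => //; apply: LL'.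
have [] := IH (add K) (subadd K) _ _ _ (add \o J).
- by move/(_ _ (addP K)).
- exact: saturation_saturated.
- by apply: subset_trans IK _; apply: subadd.
- by move=> n; apply: saturation_saturated.
- by move=> n; apply: addS.
- by move=> n; apply: addS.
move=> N addN.
have decJ' m n : (m <= n)%N -> J n `<=` J m.
  elim: n => [|n IHn]; first by rewrite leqn0 => /eqP->.
  rewrite leq_eqVlt => /predU1P[->//|]; rewrite ltnS => /IHn.
  exact: subset_trans.
have [allb|] := pselect (forall n, J n b).
  exists N => n Nn z Jz.
  have [s Ps [c _ Jc]] := addN n Nn z (subadd _ _ Jz).
  apply: (satJ _ _ _ Ps); apply: (ideal_subK _ Jc).
  exact/idealM/allb.
move/existsNP=> [m Jmb]; exists (maxn m N) => n.
rewrite geq_max => /andP[mn Nn] z Jz.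
have [s Ps [c _ Jc]] := addN n Nn z (subadd _ _ Jz).
apply: (satJ _ _ _ Ps); apply: (ideal_subK _ Jc).
(* If [c] is in [P], then [c * b] is in [K]; otherwise [c] is invertible at [P] and [b] would lie in
   [J n], although it has already left at stage [m]. *)
have [Pc|nPc] := pselect (P c); first exact/KJ/Pb.
case: Jmb; apply: (decJ' _ _ mn); apply: (satJ _ _ _ nPc).
have -> : c * b = s * z - (s * z - c * b) by ring.
by apply: idealB; [apply: idealM | apply: decJ Jc].
Qed.

(** Krull's theorem in [A / P0]: a prime minimal over [x] has height at most one, whereas [P] has
    height at least two there. The conclusion is phrased for rerouting a chain through a prime
    containing [x]. *)
Lemma principal_ideal_theorem P0 Q P x :
  prime_ideal P0 -> prime_ideal Q -> prime_ideal P ->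
  P0 `<` Q -> Q `<` P -> P x ->
  exists P', [/\ prime_ideal P', P0 `<=` P', P' x & P' `<` P].
Proof.
move=> P0p Qp Pp [P0Q QP0] [QP PQ] Px; apply: contrapT => noP'.
have [Q1 QM] := Qp; have [P01 P0M] := P0p.
have Qx : ~ Q x by move=> Qx; apply: noP'; exists Q.
pose I := ideal_adjoin P0 (unit_ideal A) x.
have minP P' : prime_ideal P' -> I `<=` P' -> P' `<=` P -> P `<=` P'.
  move=> P'p IP' P'P; apply: contrapT => PP'; apply: noP'; exists P'; split=> //.
    by apply: subset_trans IP'; apply: sub_ideal_adjoin.
  exact/IP'/mem_ideal_adjoin.
(* The symbolic powers of [Q] modulo [P0]: with [x] added and localized at [P]
   they become stationary, hence are stationary by Nakayama's lemma at [P], and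
   Nakayama's lemma at [Q] then kills them. *)
pose Qn n := saturation (prime_compl Qp) (ideal_sum P0 (ideal_exp Q n)).
have expS n : ideal_exp Q n.+1 `<=` ideal_exp Q n.
  by apply: ideal_gen_sub => _ [a _ [b Qb <-]]; apply: idealM.
have decQ n : Qn n.+1 `<=` Qn n.
  move=> z [s Qs [w P0w Ew]]; exists s => //; exists w => //; exact: expS.
have satQ n : saturated Q (Qn n) by apply: saturation_saturated.
have P0Qn n : P0 `<=` Qn n.
  by apply: subset_trans (@sub_saturation _ _ _ _); apply: sub_ideal_suml.
pose J n := saturation (prime_compl Pp) (ideal_adjoin (Qn n) (unit_ideal A) x).
have [|||N JN] := @saturated_dcc P I J Pp minP.
- by move=> n; apply: saturation_saturated.
- by move=> n z [s Ps [c _ Qc]]; exists s => //; exists c => //; apply: decQ.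
- move=> n; apply: subset_trans (@sub_saturation _ _ _ _).
  by move=> z [c _ P0c]; exists c => //; apply: P0Qn.
have QnN : Qn N `<=` Qn N.+1.
  move=> z Qz; have [|u nPu Qu] := @nakayama _ noethA P (Qn N) (Qn N.+1) Pp _ z Qz.
    move=> {Qz}z Qz; have [|s nPs [c _ Qc]] := JN N (leqnn _) z.
      exact/sub_saturation/sub_ideal_adjoin.
    (* As [c * x] lies in [Qn N], which is saturated at [Q], and [x] is outside [Q], also [c] lies
       in [Qn N]; hence [c * x] is in [P * Qn N]. *)
    exists s => //; exists (s * z - c * x) => //; rewrite subKr mulrC.
    apply: sub_ideal_gen; exists x => //; exists c => //.
    apply: (satQ _ _ _ Qx); rewrite mulrC.
    have -> : c * x = s * z - (s * z - c * x) by ring.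
    by apply: idealB; [apply: idealM | apply: decQ].
  by apply: satQ Qu => Qu; apply/nPu/QP.
have expP0 z : ideal_exp Q N z -> P0 z.
  move=> Ez; have [|u Qu P0u] := @nakayama _ noethA Q (ideal_exp Q N) P0 Qp _ z Ez.
    move=> {Ez}z Ez; apply: QnN; exists 1 => //; rewrite mul1r.
    exact: sub_ideal_sumr.
  by have [/P0Q|] := P0M _ _ P0u.
apply: QP0 => z Qz; apply: (primeX (n := N)) => //; apply: expP0.
elim: N {QnN JN} => [|n IHn]; first exact: sub_ideal_gen.
by rewrite exprS; apply: sub_ideal_gen; exists z => //; exists (z ^+ n).
Qed.

End PrincipalIdealTheorem.

(** * Chains of primes and their behaviour modulo [f] *)

Section Chains.
Variable A : comPzRingType.
Implicit Types (I J P : ideal A).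

(** Chains of length [n] in the quotient by the ideal that [S] generates, so dimensions are compared
    length by length without suprema. *)
Definition has_chain_above (S : set A) n :=
  exists2 P : nat -> ideal A, prime_chain n P & S `<=` P 0%N.

Lemma prime_chain_sub n (P : nat -> ideal A) k :
  prime_chain n P -> (k <= n)%N -> P 0%N `<=` P k.
Proof.
move=> [_ sP]; elim: k => [_ x|k IHk kn] //.
by have [PP _] := sP k kn; apply: subset_trans PP; apply/IHk/ltnW.
Qed.

Lemma prime_chain_cons n (P : nat -> ideal A) Q :
  prime_chain n P -> prime_ideal Q -> Q `<` P 0%N ->
  prime_chain n.+1 (fun k => if k is k'.+1 then P k' else Q).
Proof. by move=> [Pp sP] Qp QP; split=> -[|k]//; [apply: Pp|apply: sP]. Qed.

Lemma prime_chain_behead n (P : nat -> ideal A) :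
  prime_chain n.+1 P -> prime_chain n (P \o succn).
Proof. by move=> [Pp sP]; split=> k kn; [apply: Pp|apply: sP]. Qed.

Lemma prime_chain_rcons n (P : nat -> ideal A) Q :
  prime_chain n P -> prime_ideal Q -> P n `<` Q ->
  prime_chain n.+1 (fun k => if (k <= n)%N then P k else Q).
Proof.
move=> [Pp sP] Qp PQ; split=> k.
  by move=> _; case: leqP => [kn|_] //; exact: Pp.
rewrite ltnS => kn; rewrite kn; have [kn'|nk] := ltnP k n; first exact: sP.
by have -> : k = n by apply/eqP; rewrite eqn_leq kn.
Qed.

(** Work from the top: once the chain without its first prime has been moved above [x], the
    principal ideal theorem replaces [P 1] by a prime containing [x] between [P 0] and the new
    chain. *)
Lemma prime_chain_descend n (P : nat -> ideal A) x :
  noetherian A -> prime_chain n.+1 P -> P n.+1 x -> ~ P 0%N x ->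
  exists P' : nat -> ideal A, [/\ prime_chain n P', P 0%N `<=` P' 0%N & P' 0%N x].
Proof.
move=> noethA; elim: n P => [|n IHn] P chP Px nPx.
  exists (P \o succn); split=> //; first exact: prime_chain_behead.
  exact: prime_chain_sub chP _.
have chP' := prime_chain_behead chP.
have [P1x|nP1x] := pselect (P 1%N x).
  exists (P \o succn); split=> //=.
  exact: prime_chain_sub chP _.
have [P' [chP'' PP' P'x]] := IHn _ chP' Px nP1x.
have [Pp sP] := chP.
have [|Q [Qp PQ Qx QP']] := @principal_ideal_theorem _ noethA
    (P 0%N) (P 1%N) (P' 0%N) x (Pp 0%N isT) (Pp 1%N isT)
    ((proj1 chP'') 0%N isT) (sP 0%N isT) _ P'x.
  by split=> // /(_ _ P'x).
exists (fun k => if k is k'.+1 then P' k' else Q); split=> //.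
exact: prime_chain_cons.
Qed.

(* [T] is the [f]-torsion, killed by [f]. A prime not containing [f] contains
   [T], and [f] is regular modulo [T]. *)
Lemma has_chain_regular f T n : noetherian A ->
  (forall a, exists b, (1 + f * a) * b = 1) ->
  (forall x, T x -> f * x = 0) -> (forall x, T (f * x) -> T x) -> T 0 ->
  has_chain_above set0 n <->
  has_chain_above [set f] n \/
  exists2 m, n = m.+1 & has_chain_above (T `|` [set f]) m.
Proof.
move=> noethA jacf fT Tf T0; split=> [[P chP _]|[[P chP _]|[m -> [P chP TP]]]].
- have Pp := proj1 chP.
  have [P0f|nP0f] := pselect (P 0%N f); first by left; exists P => // _ ->.
  have TP P' : prime_ideal P' -> ~ P' f -> T `<=` P'.
    move=> [_ P'M] nP'f x Tx; have [|//|//] := P'M f x.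
    by rewrite fT //; apply: ideal0.
  have [Pnf|nPnf] := pselect (P n f).
    right; case: n chP Pp Pnf => // n chP Pp Pnf; exists n => //.
    have [P' [chP' PP' P'f]] := prime_chain_descend noethA chP Pnf nP0f.
    by exists P' => // x [/TP Tx|-> //]; apply/PP'/Tx => //; apply: Pp.
  (* As [f] is in the Jacobson radical, [P n + (f)] is proper, so the chain extends by a prime [Q]
     containing [f]; the descent then costs only this extra step. *)
  left; have [[a _ Pa]|Q Qp PQ] :=
    @exists_prime_above _ noethA (ideal_adjoin (P n) (unit_ideal A) f).
    have [b ab] := jacf (- a); apply: (proj1 (Pp n (leqnn n))).
    by rewrite -ab mulrN mulrC [f * a]mulrC; apply: idealM.
  have Qf : Q f by apply/PQ/mem_ideal_adjoin.
  have chQ : prime_chain n.+1 (fun k => if (k <= n)%N then P k else Q).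
    apply: prime_chain_rcons => //; split=> [|/(_ _ Qf)//].
    by apply: subset_trans PQ; apply: sub_ideal_adjoin.
  have [|//|P' [chP' _ P'f]] := prime_chain_descend (x := f) noethA chQ.
    by rewrite ltnn.
  by exists P' => // _ ->.
- by exists P.
have Pp := proj1 chP 0%N (leq0n _); have [P1 PM] := Pp.
(* A prime missing [S] lies inside [P 0] and omits [f], so it prolongs the chain below. [S] misses
   zero because [f] is regular modulo [T] and [T] lies in [P 0]. *)
pose S := [set y | exists k s, ~ P 0%N s /\ y = f ^+ k * s].
have SM : mult_closed S.
  split; first by exists 0%N, 1; rewrite mulr1.
  move=> _ _ [k [s [Ps ->]]] [l [t [Pt ->]]]; exists (k + l)%N, (s * t).
  by split; [case/PM | rewrite exprD mulrACA].
have [|Q [Qp _ QS]] := @prime_avoiding _ noethA S (zero_ideal A) SM.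
  move=> _ [-> [k [s [Ps fs0]]]]; apply: Ps; apply: TP; left.
  have: T (f ^+ k * s) by rewrite -fs0.
  elim: k {fs0} => [|k IHk]; first by rewrite mul1r.
  by rewrite exprS -mulrA => /Tf.
have nQf : ~ Q f.
  by move=> Qf; apply: (QS f); split=> //; exists 1%N, 1; rewrite mulr1.
exists (fun k => if k is k'.+1 then P k' else Q) => //.
apply: prime_chain_cons => //; split; last first.
  by move/(_ f) => H; apply/nQf/H/TP; right.
move=> x Qx; apply: contrapT => Px; apply: (QS x); split=> //.
by exists 0%N, x; rewrite mul1r.
Qed.

End Chains.

(** * Prime chains under surjective ring maps *)

Section Transfer.
Variables (A B : comPzRingType) (f : {rmorphism A -> B}).
Hypothesis f_surj : forall y, exists x, f x = y.
Implicit Types (I P : ideal A) (J Q : ideal B).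

Definition ideal_preim Q : ideal A.
Proof.
exists [set x | Q (f x)] => [|x y|a x] /=; first by rewrite rmorph0; apply: ideal0.
- by rewrite rmorphD; apply: idealD.
- by rewrite rmorphM; apply: idealM.
Defined.

Definition ideal_im P : ideal B.
Proof.
exists [set f x | x in P].
- by exists 0; rewrite ?rmorph0 //; apply: ideal0.
- move=> _ _ [x Px <-] [y Py <-]; exists (x + y); last exact: rmorphD.
  exact: idealD.
- move=> b _ [x Px <-]; have [a <-] := f_surj b; exists (a * x).
    exact: idealM.
  exact: rmorphM.
Defined.

Lemma noetherian_im : noetherian A -> noetherian B.
Proof.
move=> noethA; apply/noetherianP => Q.
have [s sQ] := (noetherianP A).1 noethA (ideal_preim Q).
exists (map f s); apply/seteqP; split; last first.
  by apply: ideal_span_sub => _ /mapP[x /mem_ideal_span xs ->]; rewrite -sQ in xs.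
move=> y Qy; have [x xy] := f_surj y; rewrite -xy in Qy *.
have : ideal_span s x by rewrite -sQ.
apply: (@ideal_span_sub _ s (ideal_preim (ideal_span (map f s)))) => z zs.
exact/mem_ideal_span/map_f.
Qed.

(** The preimage of [S'] contains [S] and the kernel of [f], and lies in the radical of the ideal
    generated by [S]; so the primes over [S] are exactly the preimages of the primes over [S']. *)
Lemma has_chain_im (S : set A) (S' : set B) n : S' 0 -> f @` S `<=` S' ->
  (forall x, S' (f x) -> exists k, ideal_gen S (x ^+ k)) ->
  has_chain_above S n <-> has_chain_above S' n.
Proof.
move=> S'0 SS' radS; split=> -[P [Pp sP] SP].
  have kerP k : (k <= n)%N -> forall x, S' (f x) -> P k x.
    move=> kn x /radS[l Sx]; apply: (primeX (n := l)); first exact: Pp.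
    apply: ideal_gen_sub Sx; apply: subset_trans SP _.
    exact: prime_chain_sub (conj Pp sP) kn.
  have imP k x : (k <= n)%N -> ideal_im (P k) (f x) -> P k x.
    move=> kn [y Py fxy]; apply: ideal_subK Py _; apply: kerP => //.
    by rewrite rmorphB fxy subrr.
  exists (fun k => ideal_im (P k)); last first.
    move=> y; have [x <-] := f_surj y => S'x; exists x => //.
    exact: kerP.
  split=> k kn.
    have [P1 PM] := Pp k kn; split; first by rewrite -(rmorph1 f) => /imP-/(_ kn).
    move=> x y; have [a <-] := f_surj x; have [b <-] := f_surj y.
    rewrite -rmorphM => /imP-/(_ kn)/PM[Pa|Pb]; [left; exists a|right; exists b] => //.
  have [PP nPP] := sP k kn; split=> [_ [x Px <-]|imPP].
    by exists x => //; apply: PP.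
  apply: nPP => x Px; apply: imP; first exact: ltnW.
  by apply: imPP; exists x.
exists (fun k => ideal_preim (P k)); last by move=> x Sx; apply/SP/SS'; exists x.
split=> k kn.
  have [P1 PM] := Pp k kn; split; rewrite /= ?rmorph1 // => x y.
  by rewrite rmorphM => /PM.
have [PP nPP] := sP k kn; split=> [x|H]; first exact: PP.
by apply: nPP => y; have [x <-] := f_surj y; apply: H.
Qed.

End Transfer.

(** * Complete rings *)

(** The dimension formula read off in [C], a copy of [A / a]. Layers and small tilts both enter in
    this form. *)
Lemma has_chain_mod_regular (A C : comPzRingType) (f : {rmorphism A -> C})
    (a : A) (T : ideal A) (U : ideal C) n :
  noetherian A -> (forall x, exists y, (1 + a * x) * y = 1) ->
  (forall x, T x -> a * x = 0) -> (forall x, T (a * x) -> T x) ->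
  (forall y, exists x, f x = y) -> (forall x, f x = 0 <-> exists c, x = c * a) ->
  U = f @` T :> set C ->
  has_chain_above (set0 : set A) n <->
  has_chain_above [set (0 : C)] n \/
  exists2 m, n = m.+1 & has_chain_above U m.
Proof.
move=> noethA jac aT Ta fsurj kerf UT.
have fa : f a = 0 by apply/kerf; exists 1; rewrite mul1r.
have E0 m : has_chain_above [set a] m <-> has_chain_above [set (0 : C)] m.
  apply: (has_chain_im fsurj) => //; first by move=> _ [_ -> <-].
  by move=> x /kerf ax; exists 1%N; apply/ideal_gen1P.
have ET m : has_chain_above (T `|` [set a]) m <-> has_chain_above U m.
  apply: (has_chain_im fsurj); first exact: ideal0.
    move=> _ [x [Tx|->] <-]; first by rewrite UT; exists x.
    by rewrite fa; apply: ideal0.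
  rewrite UT => x [y Ty fyx]; exists 1%N; apply: (@ideal_subK _ _ _ y).
    by apply: sub_ideal_gen; left.
  have /kerf[c ->] : f (x - y) = 0 by rewrite rmorphB fyx subrr.
  by apply/idealM/sub_ideal_gen; right.
rewrite (has_chain_regular n noethA jac aT Ta (ideal0 T)) E0.
by split=> -[|[m nm]]; [left|move/ET; right; exists m|left|move/ET; right; exists m].
Qed.

Section Complete.
Variables (A B : comPzRingType) (f : {rmorphism B -> A}) (e : B).
Hypothesis f_surj : forall y, exists x, f x = y.
Hypothesis ker_f : forall x, f x = 0 <-> exists c, x = c * e.
(** A form of [e]-adic separatedness: such a [d 0] is divisible by every power of [e]. *)
Hypothesis e_separated :
  forall d : nat -> B, (forall n, d n = e * d n.+1) -> d 0%N = 0.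
(* [s n] is the sum of the series [\sum_k e ^+ k * c (n + k)]. *)
Hypothesis e_complete :
  forall c : nat -> B, exists s, forall n, s n = c n + e * s n.+1.
Hypothesis noethA : noetherian A.
Implicit Types (J : ideal B) (s : seq B).

(** The inverse is the geometric series in [- e * a]; separatedness shows that its tail [s 1] equals
    [- a * s 0]. *)
Lemma complete_jacobson a : exists b, (1 + e * a) * b = 1.
Proof.
have [s sE] := e_complete (fun n => (- a) ^+ n).
have s1 : s 1%N + a * s 0%N = 0.
  apply: (e_separated (d := fun n => s n.+1 + a * s n)) => n.
  by rewrite {1}[s n.+1]sE [s n]sE exprS; ring.
exists (s 0%N); have s0 := sE 0%N; rewrite expr0 in s0.
have -> : (1 + e * a) * s 0%N = s 0%N - e * s 1%N + e * (s 1%N + a * s 0%N) by ring.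
by rewrite s1 mulr0 addr0 {1}s0 addrK.
Qed.

(** [z 0] is the telescoping sum of [e ^+ n * (z n - e * z n.+1)]. The coefficients of each
    generator are summed separately, and separatedness handles the empty list. *)
Lemma ideal_span_series s (z : nat -> B) :
  (forall n, ideal_span s (z n - e * z n.+1)) -> ideal_span s (z 0%N).
Proof.
elim: s z => [|x s IHs] z zs.
  by apply: e_separated => n; apply/eqP; rewrite -subr_eq0; apply/eqP/zs.
have /choice[c cP] n : exists c, ideal_span s (z n - e * z n.+1 - c * x).
  by have [c] := zs n; exists c.
have [t tE] := e_complete c.
exists (t 0%N) => //; apply: (IHs (fun n => z n - t n * x)) => n.
have -> : z n - t n * x - e * (z n.+1 - t n.+1 * x) =
  z n - e * z n.+1 - c n * x by rewrite [t n]tE; ring.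
exact: cP.
Qed.

(** Lift generators of the image of [J] in [A]. The error [c * e] is a difference of elements of
    [J], which puts [c] in [colon J e]. *)
Lemma fin_gen_mod J : exists2 s, (forall z, z \in s -> J z) &
  forall x, J x -> exists2 c, colon J e c & ideal_span s (x - c * e).
Proof.
have [s sJ] := (noetherianP A).1 noethA (ideal_im f_surj J).
have [s' [s'J s'E]] : exists s', (forall z, z \in s' -> J z) /\ map f s' = s.
  have {sJ} : forall z, z \in s -> ideal_im f_surj J z.
    by move=> z /mem_ideal_span; rewrite -sJ.
  elim: s => [|y s IHs] sJ; first by exists [::].
  have [x Jx xy] := sJ y (mem_head y s).
  have [|s' [s'J s'E]] := IHs; first by move=> z zs; apply: sJ; rewrite inE zs orbT.
  exists (x :: s'); split; last by rewrite /= xy s'E.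
  by move=> z; rewrite inE => /predU1P[->|/s'J].
exists s' => // x Jx.
have {sJ} : ideal_span (map f s') (f x) by rewrite s'E -sJ; exists x.
move=> /(@ideal_span_sub _ _ (ideal_im f_surj (ideal_span s'))) [|w sw fwx].
  by move=> _ /mapP[z /mem_ideal_span zs ->]; exists z.
have [|c xwc] := (ker_f (x - w)).1; first by rewrite rmorphB fwx subrr.
exists c; last by rewrite -xwc subKr.
rewrite /= -xwc; apply: idealB => //.
exact: ideal_span_sub sw.
Qed.

Lemma fin_gen_colon J : fin_gen (colon J e) -> fin_gen J.
Proof.
move=> [t tJ]; have [s sJ Js] := fin_gen_mod J.
pose st := s ++ [seq c * e | c <- t].
have ts c : ideal_span t c -> ideal_span st (c * e).
  apply: (@ideal_span_sub _ _ (colon (ideal_span st) e)) => z zt /=.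
  by apply: mem_ideal_span; rewrite mem_cat; apply/orP; right; apply/mapP; exists z.
exists st; apply/seteqP; split=> [x Jx|].
  have [c Jc xc] := Js x Jx; apply: (@ideal_subK _ _ _ (c * e)).
    by apply: ts; rewrite -tJ.
  apply: ideal_span_sub xc => z zs; apply: mem_ideal_span.
  by rewrite mem_cat zs.
apply: ideal_span_sub => z; rewrite mem_cat => /orP[/sJ//|/mapP[c ct ->]].
have : colon J e c by rewrite tJ; apply: mem_ideal_span.
by [].
Qed.

(** Saturation keeps the quotient of the error by [e] inside [J], so the approximation can be
    iterated and summed as a series. *)
Lemma fin_gen_saturated J : colon J e `<=` J -> fin_gen J.
Proof.
move=> satJ; have [s sJ Js] := fin_gen_mod J; exists s.
apply/seteqP; split; last exact: ideal_span_sub.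
have /choice[g gP] x : exists c, J x -> J c /\ ideal_span s (x - e * c).
  have [/Js[c Jc xc]|nJx] := pselect (J x); last by exists x.
  by exists c => _; split; [apply: satJ|rewrite mulrC].
move=> x Jx; pose z n := iter n g x.
have Jz n : J (z n) by elim: n => //= n /gP[].
by apply: (ideal_span_series (z := z)) => n; have [] := gP _ (Jz n).
Qed.

(* An ideal [J] is finitely generated as soon as [colon J e] is, and the ideals
   [colon J (e ^+ n)] end up being [e]-saturated. *)
Lemma noetherian_complete : noetherian B.
Proof.
apply/noetherianP => J.
(* The union of all [colon J (e ^+ n)] is saturated, hence finitely generated, so one exponent [N]
   serves for all of it. *)
have [N NJ] : exists N, forall x n, J (e ^+ n * x) -> J (e ^+ N * x).
  pose S := [set y | exists n, y = e ^+ n].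
  have SM : mult_closed S.
    split; first by exists 0%N.
    by move=> _ _ [m ->] [n ->]; exists (m + n)%N; rewrite exprD.
  have [|s sJ] := @fin_gen_saturated (saturation SM J).
    move=> x [_ [n ->] Jx]; exists (e ^+ n.+1); first by exists n.+1.
    by rewrite exprSr -mulrA [e * x]mulrC.
  have [N NJ] : exists N, forall z, z \in s -> J (e ^+ N * z).
    have {sJ} : forall z, z \in s -> saturation SM J z.
      by move=> z /mem_ideal_span; rewrite -sJ.
    elim: s => [|y s IHs] sJ; first by exists 0%N.
    have [_ [m ->] Jy] := sJ y (mem_head y s).
    have [|n Jn] := IHs; first by move=> z zs; apply: sJ; rewrite inE zs orbT.
    exists (m + n)%N => z; rewrite inE => /predU1P[->|/Jn].
      by rewrite addnC exprD -mulrA; apply: idealM.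
    by rewrite exprD -mulrA; apply: idealM.
  exists N => x n Jx; have : ideal_span s x.
    by rewrite -sJ; exists (e ^+ n) => //; exists n.
  rewrite mulrC; apply: (@ideal_span_sub _ _ (colon J (e ^+ N))) => z /NJ /=.
  by rewrite mulrC.
(* Passing from [J] to [colon J e] lowers [N] by one; at zero, [J] is saturated. *)
elim: N J NJ => [|N IHN] J NJ.
  apply: fin_gen_saturated => x Jx; rewrite -[x]mul1r -(expr0 e).
  by apply: (NJ _ 1%N); rewrite expr1 mulrC.
apply/fin_gen_colon/IHN => x n /= Jx.
by rewrite mulrAC -exprSr; apply: (NJ x n.+1); rewrite exprSr mulrAC.
Qed.

End Complete.

(** * Limits along Frobenius projections *)

Section LimProj.
Variables (Q : nat -> comPzRingType) (F : forall m, {rmorphism Q m.+1 -> Q m}).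

Definition lim_pr m (x : ring_lim F) : Q m := lim_proj x m.

Lemma lim_pr_zmod m : zmod_morphism (lim_pr m). Proof. by []. Qed.
Lemma lim_pr_monoid m : monoid_morphism (lim_pr m). Proof. by []. Qed.
HB.instance Definition _ m :=
  GRing.isZmodMorphism.Build (ring_lim F) (Q m) (lim_pr m) (lim_pr_zmod m).
HB.instance Definition _ m :=
  GRing.isMonoidMorphism.Build (ring_lim F) (Q m) (lim_pr m) (lim_pr_monoid m).

Lemma lim_prB m : {morph lim_pr m : x y / x - y}.
Proof. exact: rmorphB. Qed.
Lemma lim_prD m : {morph lim_pr m : x y / x + y}.
Proof. exact: rmorphD. Qed.
Lemma lim_prM m : {morph lim_pr m : x y / x * y}.
Proof. exact: rmorphM. Qed.
Lemma lim_prX m n : {morph lim_pr m : x / x ^+ n}.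
Proof. exact: rmorphXn. Qed.
Lemma lim_pr0 m : lim_pr m 0 = 0.
Proof. exact: rmorph0. Qed.

Lemma lim_prF m x : F m (lim_pr m.+1 x) = lim_pr m x.
Proof. exact: lim_projP. Qed.

Lemma lim_lift (R : forall m, set (Q m)) x0 :
  (forall m y, R m y -> exists2 x, R m.+1 x & F m x = y) -> R 0%N x0 ->
  exists2 x : ring_lim F, lim_pr 0 x = x0 & forall m, R m (lim_pr m x).
Proof.
move=> RF Rx0.
have /(_ _)/choice step m :
    forall y : Q m, exists x, R m y -> R m.+1 x /\ F m x = y.
  move=> y; have [/RF[x Rx Fx]|nRy] := pselect (R m y); last by exists 0.
  by exists x.
pose g m := projT1 (step m).
have gP m y : R m y -> R m.+1 (g m y) /\ F m (g m y) = y
  by rewrite /g; case: (step m) => h /= hP; apply: hP.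
pose u := fix u m : Q m := if m is k.+1 then g k (u k) else x0.
have Ru m : R m (u m) by elim: m => //= m /gP[].
by exists (RingLim (fun m => proj2 (gP m _ (Ru m)))).
Qed.

End LimProj.

(** Induction on [m] over all sequences: a point of the limit of the shifted sequence extends
    downwards by applying [F 0]. *)
Lemma lim_pr_surj m (Q : nat -> comPzRingType)
    (F : forall m, {rmorphism Q m.+1 -> Q m}) :
  (forall m y, exists x, F m x = y) ->
  forall x : Q m, exists y : ring_lim F, lim_pr m y = x.
Proof.
elim: m Q F => [|m IHm] Q F Fsurj x0.
  have [m y _|//|x xx0 _] := @lim_lift Q F (fun m => setT) x0.
    by have [x] := Fsurj m y; exists x.
  by exists x.
have [x xx0] := IHm (Q \o succn) (fun m => F m.+1) (fun m => Fsurj m.+1) x0.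
pose u m : Q m := if m is k.+1 then lim_pr k x else F 0%N (lim_pr 0 x).
have uF k : F k (u k.+1) = u k by case: k => //= k; exact: (lim_projP x).
by exists (RingLim uF).
Qed.

(** * Dimension of the limit of layers [Q m] with torsion images [U m] *)

Section AbstractTilt.
Variables (Q : nat -> comPzRingType) (p : nat).
Variables (F : forall m, {rmorphism Q m.+1 -> Q m}).
Variables (t : forall m, {rmorphism Q m -> Q m.+1}).
Variables (g : forall m, Q m.+1) (U : forall m, ideal (Q m)).
Hypothesis p_gt1 : (1 < p)%N.
Hypothesis F_surj : forall m y, exists x, F m x = y.
Hypothesis tF : forall m x, t m (F m x) = x ^+ p.
Hypothesis ker_F : forall m x, F m x = 0 <-> exists c, x = c * g m.
Hypothesis tg : forall m, t m.+1 (g m) = g m.+1.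
Hypothesis noethQ0 : noetherian (Q 0).
Hypothesis F_U : forall m x, U m.+1 x -> U m (F m x).
Hypothesis F_U_inj : forall m x, U m.+1 x -> F m x = 0 -> x = 0.
Hypothesis F_U_surj : forall m y, U m y -> exists2 x, U m.+1 x & F m x = y.
Hypothesis g_torsion : forall m x, g m * x = 0 -> U m (F m x).

Local Notation B := (ring_lim F).
Let surj m := @lim_pr_surj m Q F F_surj.

Section Uniformizer.
Variable e : B.
Hypothesis e1 : lim_pr 1 e = g 0.

Lemma F_g m : F m (g m) = 0.
Proof. by apply/ker_F; exists 1; rewrite mul1r. Qed.

(** By [tF], the [p]-th power of a coordinate is [t] of the one below. Thus powers of the single
    element [e] generate all the kernels. *)
Lemma lim_pr_exp_p m : lim_pr m.+1 e ^+ (p ^ m) = g m.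
Proof.
elim: m => [|m IHm]; first by rewrite expn0 expr1.
by rewrite expnS exprM -tF lim_prF -rmorphXn IHm tg.
Qed.

(** The [p]-th power of [g m] is [t (F (g m)) = 0]. Each coordinate therefore sees only finitely
    many powers of [e]. *)
Lemma lim_pr_exp0 m n : (p ^ m <= n)%N -> lim_pr m e ^+ n = 0.
Proof.
move=> /subnKC <-; rewrite exprD; case: m => [|m].
  by rewrite expn0 expr1 -lim_prF e1 F_g mul0r.
by rewrite expnSr exprM lim_pr_exp_p -tF F_g rmorph0 mul0r.
Qed.

Lemma lim_eq0 (x : B) : (forall m, lim_pr m x = 0) -> x = 0.
Proof. by move=> x0; apply: ring_lim_eq => m; apply: x0. Qed.

Lemma lim_separated (d : nat -> B) : (forall n, d n = e * d n.+1) -> d 0%N = 0.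
Proof.
move=> dE; apply: lim_eq0 => m.
have dX n : d 0%N = e ^+ n * d n.
  by elim: n => [|n ->]; rewrite ?mul1r // exprSr -mulrA -dE.
by rewrite (dX (p ^ m)%N) lim_prM lim_prX lim_pr_exp0 ?mul0r.
Qed.

Lemma lim_complete (c : nat -> B) : exists s, forall n, s n = c n + e * s n.+1.
Proof.
(* The partial sums of [e ^+ k * c (n + k)] over [k < N]; at coordinate [m] they are constant from
   [N = p ^ m] on. *)
pose part := fix part N n := if N is N'.+1 then c n + e * part N' n.+1 else 0.
have partS N n : part N.+1 n - part N n = e ^+ N * c (n + N)%N.
  elim: N n => [|N IHN] n; first by rewrite /= mulr0 addr0 subr0 mul1r addn0.
  rewrite -[LHS]/(c n + e * part N.+1 n.+1 - (c n + e * part N n.+1)).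
  by rewrite opprD addrACA subrr add0r -mulrBr IHN addSnnS exprS mulrA.
have prS m N n : (p ^ m <= N)%N -> lim_pr m (part N.+1 n) = lim_pr m (part N n).
  move=> mN; apply/eqP; rewrite -subr_eq0 -lim_prB partS lim_prM lim_prX.
  by rewrite lim_pr_exp0 ?mul0r.
have prN m N n : (p ^ m <= N)%N -> lim_pr m (part N n) = lim_pr m (part (p ^ m)%N n).
  elim: N => [|N IHN]; first by rewrite leqn0 => /eqP->.
  by rewrite leq_eqVlt => /predU1P[->//|]; rewrite ltnS => mN; rewrite prS ?IHN.
have sP n m : F m (lim_pr m.+1 (part (p ^ m.+1)%N n)) = lim_pr m (part (p ^ m)%N n).
  by rewrite lim_prF prN // leq_exp2l.
exists (fun n => RingLim (sP n)) => n; apply: ring_lim_eq => m.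
by rewrite -[LHS]/(lim_pr m (part (p ^ m)%N n)) -prS.
Qed.

(** Successive approximation of the quotient: if [x - e * y] vanishes at coordinate [n], then at
    [n.+1] it is a multiple of [g n], that is of [e ^+ (p ^ n)], so [y] is corrected by a multiple
    of [e ^+ (p ^ n).-1]. *)
Lemma ker_lim_pr0 x : lim_pr 0 x = 0 <-> exists c, x = c * e.
Proof.
split=> [x0|[c ->]]; last first.
  by rewrite lim_prM -[X in _ * X]lim_prF e1 F_g mulr0.
have step n (y : B) : exists y' : B, lim_pr n (x - e * y) = 0 ->
    lim_pr n.+1 (x - e * y') = 0 /\
    exists q, y' = y + e ^+ (p ^ n).-1 * q.
  have [xy|nxy] := pselect (lim_pr n (x - e * y) = 0); last by exists y.
  move: (xy); rewrite -lim_prF => /ker_F[c cE]; have [q qE] := surj c.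
  exists (y + e ^+ (p ^ n).-1 * q) => _; split; last by exists q.
  have -> : x - e * (y + e ^+ (p ^ n).-1 * q) = x - e * y - e ^+ (p ^ n) * q.
    by rewrite -[in RHS](@prednK (p ^ n)) ?expn_gt0 ?(ltnW p_gt1) // exprS; ring.
 by rewrite lim_prB cE lim_prM lim_prX lim_pr_exp_p qE mulrC subrr.
have /choice[h hP] ny : exists y' : B, lim_pr ny.1 (x - e * ny.2) = 0 ->
    lim_pr ny.1.+1 (x - e * y') = 0 /\
    exists q, y' = ny.2 + e ^+ (p ^ ny.1).-1 * q by exact: step.
pose y := fix y n : B := if n is k.+1 then h (k, y k) else 0.
have yE n : lim_pr n (x - e * y n) = 0.
  by elim: n => [|n IHn]; [rewrite mulr0 subr0|have [] := hP (n, y n) IHn].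
(* The correction carries exponent [p ^ n.+1 - 1], at least [p ^ n], and so vanishes at coordinate
   [n]. Hence coordinate [m] of the quotient is taken from [y m.+1]. *)
have yS n : lim_pr n (y n.+2) = lim_pr n (y n.+1).
  have [_ [q hq]] := hP (n.+1, y n.+1) (yE n.+1).
  rewrite -[y n.+2]/(h (n.+1, y n.+1)) hq.
  rewrite lim_prD lim_prM lim_prX lim_pr_exp0 ?mul0r ?addr0 //.
  by rewrite -ltnS prednK ?expn_gt0 ?(ltnW p_gt1) // ltn_exp2l.
have sP m : F m (lim_pr m.+1 (y m.+2)) = lim_pr m (y m.+1) by rewrite lim_prF yS.
exists (RingLim sP); apply: ring_lim_eq => m.
have := congr1 (F m) (yE m.+1); rewrite lim_prF rmorph0 lim_prB lim_prM.
by move/eqP; rewrite subr_eq0 => /eqP; rewrite mulrC.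
Qed.

Definition lim_ideal : ideal B.
Proof.
exists [set x | forall m, U m (lim_pr m x)] => [m|x y Ux Uy m|a x Ux m].
- by rewrite lim_pr0; apply: ideal0.
- by rewrite lim_prD; apply: idealD.
- by rewrite lim_prM; apply: idealM.
Defined.

(** [e * x] stays in the [U m] and vanishes at coordinate zero; injectivity of [F] on [U] carries
    the vanishing upwards. *)
Lemma lim_ideal_mul0 x : lim_ideal x -> e * x = 0.
Proof.
move=> Ux; have Uex : lim_ideal (e * x) by apply: idealM.
apply: lim_eq0; elim=> [|m IHm].
  by apply/ker_lim_pr0; exists x; rewrite mulrC.
by apply: F_U_inj; rewrite ?lim_prF.
Qed.

Lemma lim_ideal_torsion x : lim_ideal (e * x) -> lim_ideal x.
Proof.
move=> /lim_ideal_mul0 eex.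
(* [g m.+1] is a power of [e] with exponent at least two, so it kills [x] one coordinate higher. For
   [g 0] the exponent is only one, so coordinate zero is reached by [F_U] instead. *)
have US m : U m.+1 (lim_pr m.+1 x).
  rewrite -lim_prF; apply: g_torsion; rewrite -lim_pr_exp_p -lim_prX -lim_prM.
  have /subnKC <- : (2 <= p ^ m.+1)%N.
    by apply: leq_trans p_gt1 _; rewrite -{1}(expn1 p) leq_exp2l.
  have -> : e ^+ (2 + (p ^ m.+1 - 2)) * x =
      e ^+ (p ^ m.+1 - 2) * (e * (e * x)) by rewrite addnC exprD expr2 -!mulrA.
  by rewrite eex mulr0 lim_pr0.
by case=> [|m]; [rewrite -lim_prF; apply/F_U/US | apply: US].
Qed.

Lemma lim_ideal_im : (U 0 : set _) = lim_pr 0 @` lim_ideal.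
Proof.
apply/seteqP; split=> [y Uy|_ [x Ux <-]]; last exact: Ux.
by have [x xy Ux] := lim_lift F_U_surj Uy; exists x.
Qed.

End Uniformizer.

Lemma has_chain_ring_lim n :
  has_chain_above (set0 : set B) n <->
  has_chain_above [set (0 : Q 0)] n \/
  exists2 m, n = m.+1 & has_chain_above (U 0) m.
Proof.
have [e e1] := surj (g 0).
have kere := ker_lim_pr0 e1.
have sep := lim_separated e1; have comp := lim_complete e1.
apply: (@has_chain_mod_regular B (Q 0) (lim_pr 0) e lim_ideal (U 0)) => //.
- exact: (noetherian_complete (@surj 0) kere sep comp noethQ0).
- exact: (complete_jacobson sep comp).
- exact: lim_ideal_mul0.
- exact: lim_ideal_torsion.
- exact: surj.
- exact: lim_ideal_im.
Qed.

End AbstractTilt.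

(** * Perfectoid towers *)

Lemma quot_pi_surj (A : comPzRingType) (I : ideal A) y :
  exists x, quot_pi I x = y.
Proof. by exists (repr y); apply: quot_reprK. Qed.

Lemma quot_pi_eq0 (A : comPzRingType) (I : ideal A) x :
  quot_pi I x = 0 <-> I x.
Proof.
rewrite -(rmorph0 (quot_pi I)); split=> [/quot_piP|Ix]; first by rewrite subr0.
by apply/quot_piP; rewrite subr0.
Qed.

Lemma ideal_gen_image1 (A B : comPzRingType) (f : {rmorphism A -> B}) a :
  ideal_gen (f @` ideal_gen [set a]) = ideal_gen [set f a] :> set B.
Proof.
apply/seteqP; split; apply: ideal_gen_sub.
  by move=> _ [_ /ideal_gen1P[c ->] <-]; apply/ideal_gen1P; exists (f c); apply: rmorphM.
by move=> _ ->; apply: sub_ideal_gen; exists a => //; apply: sub_ideal_gen.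
Qed.

Lemma ideal_exp_principal (A : comPzRingType) (I : ideal A) a n :
  I = ideal_gen [set a] :> set A -> ideal_exp I n `<=` ideal_gen [set a ^+ n].
Proof.
move=> Ia; elim: n => [|n IHn].
  by move=> x _; apply/ideal_gen1P; exists x; rewrite mulr1.
apply: ideal_gen_sub => _ [x + [y /IHn/ideal_gen1P[d ->] <-]].
rewrite Ia => /ideal_gen1P[c ->]; apply/ideal_gen1P; exists (c * d).
by rewrite exprS mulrACA.
Qed.

Lemma tower_map_shift (R : tower) i x :
  tower_map R i.+1 x = tower_map (tower_shift R) i (trans R 0 x).
Proof. by elim: i => //= i ->. Qed.

Lemma krull_dim_eq (A B : comPzRingType) :
  (forall n, has_chain_above (set0 : set A) n <->
             has_chain_above (set0 : set B) n) ->
  krull_dim A = krull_dim B.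
Proof.
move=> AB; rewrite /krull_dim.
have chainE (C : comPzRingType) n :
    (exists P : nat -> ideal C, prime_chain n P) <->
    has_chain_above (set0 : set C) n.
  by split=> [[P chP]|[P chP _]]; exists P.
suff -> : [set n | exists P : nat -> ideal A, prime_chain n P] =
          [set n | exists P : nat -> ideal B, prime_chain n P] by [].
by apply/seteqP; split=> n /chainE/AB/chainE.
Qed.

Section PerfectoidTowerDimension.
Variables (p : nat) (p_prime : prime p) (R : tower) (I0 : ideal (R 0%N)).
Hypothesis hR : perfectoid_tower p_prime I0.
Hypothesis noethR : forall i, noetherian (R i).
Variable f : R 0%N.
Hypothesis I0f : I0 = ideal_gen [set f] :> set (R 0%N).

Local Notation H := (pft_insep hR).
Local Notation fi i := (tower_map R i f).
Local Notation pi i := (quot_pi (ext_I0 I0 i)).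
Local Notation F i := (frob_proj p_prime H i).

Lemma ext_I0P i x : ext_I0 I0 i x <-> exists c, x = c * fi i.
Proof. by rewrite /ext_I0 I0f ideal_gen_image1; apply: ideal_gen1P. Qed.

Lemma pi_eq0 i x : pi i x = 0 <-> exists c, x = c * fi i.
Proof. by rewrite -ext_I0P; apply: quot_pi_eq0. Qed.

Lemma zariskian_fi i a : exists b, (1 + fi i * a) * b = 1.
Proof.
by apply: (pft_zariskian hR); apply/ext_I0P; exists a; rewrite mulrC.
Qed.

Lemma pow_torsion i x k : fi i ^+ k * x = 0 -> @I0_torsion R I0 i x.
Proof.
move=> fx a; rewrite I0f => /ideal_gen1P[c ->]; exists k.+1 => //.
by rewrite rmorphM exprMn [X in _ * X * _]exprS -!mulrA fx !mulr0.
Qed.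

Lemma torsion_mul0 i x : @I0_torsion R I0 i x -> fi i * x = 0.
Proof.
move=> Tx; have := pft_torsion0 hR i; move/seteqP => [+ _]; apply.
apply: sub_ideal_gen; exists (fi i); first by apply/ext_I0P; exists 1; rewrite mul1r.
by exists x.
Qed.

(** The annihilator of the generator, which supplies the ideal structure; since [I_0] kills the
    torsion, it is all of the torsion. *)
Definition torsion i : ideal (R i) := colon (zero_ideal (R i)) (fi i).

Lemma torsionE i : torsion i = @I0_torsion R I0 i :> set (R i).
Proof.
apply/seteqP; split=> x.
  by move=> xf; apply: (pow_torsion (k := 1)); rewrite expr1 mulrC.
by move=> /torsion_mul0; rewrite mulrC.
Qed.

Lemma torsion_saturated i x : torsion i (fi i * x) -> torsion i x.
Proof.
rewrite [in X in _ -> X]torsionE => fx; apply: (pow_torsion (k := 2)).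
by rewrite expr2 -mulrA mulrC; apply: fx.
Qed.

(** A torsion multiple [c * f] has [c] torsion, and then [c * f = 0]. *)
Lemma pi_torsion_inj i x : torsion i x -> pi i x = 0 -> x = 0.
Proof.
move=> Tx /pi_eq0[c xc]; rewrite xc in Tx *.
by apply: torsion_saturated; rewrite mulrC.
Qed.

Definition red_torsion i : ideal (redlayer I0 i) :=
  ideal_im (@quot_pi_surj _ (ext_I0 I0 i)) (torsion i).

Lemma F_surj i y : exists x, F i x = y.
Proof. by have /seteqP[_ /(_ y I)[x _ <-]] := pft_surj hR i; exists x. Qed.

Lemma F_red_torsion i x : red_torsion i.+1 x -> red_torsion i (F i x).
Proof.
have [Ft [[Ff _ _] FE]] := pft_torsion hR i.
move=> [y Ty <-]; rewrite torsionE in Ty; exists (Ft y); last exact: esym (FE _ Ty).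
by rewrite torsionE; apply: Ff.
Qed.

(** The torsion bijection [Ft] is not assumed additive, so [Ft y] and [Ft 0] are each shown to be
    zero before injectivity is used. *)
Lemma F_red_torsion_inj i x : red_torsion i.+1 x -> F i x = 0 -> x = 0.
Proof.
have [Ft [[Ff Finj _] FE]] := pft_torsion hR i.
have Ft0 y : @I0_torsion R I0 i.+1 y -> F i (pi i.+1 y) = 0 -> Ft y = 0.
  move=> Ty; rewrite FE // => /pi_torsion_inj; apply.
  by rewrite torsionE; apply: Ff.
have T0 : @I0_torsion R I0 i.+1 0 by rewrite -torsionE; apply: ideal0.
move=> [y Ty <-] Fy; rewrite torsionE in Ty.
suff -> : y = 0 by rewrite rmorph0.
apply: Finj; rewrite ?inE // Ft0 // Ft0 //.
by rewrite !rmorph0.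
Qed.

Lemma F_red_torsion_surj i y :
  red_torsion i y -> exists2 x, red_torsion i.+1 x & F i x = y.
Proof.
have [Ft [[_ _ Fsurj] FE]] := pft_torsion hR i.
move=> [z Tz <-]; rewrite torsionE in Tz; have [x Tx <-] := Fsurj _ Tz.
by exists (pi i.+1 x); [exists x; rewrite ?torsionE|apply: FE].
Qed.

Definition red_dim_cond i n :=
  has_chain_above [set (0 : redlayer I0 i)] n \/
  exists2 m, n = m.+1 & has_chain_above (red_torsion i) m.

Lemma has_chain_layer i n :
  has_chain_above (set0 : set (R i)) n <-> red_dim_cond i n.
Proof.
apply: (@has_chain_mod_regular _ _ (pi i) (fi i) (torsion i)) => //.
- exact: zariskian_fi.
- by move=> x; rewrite mulrC.
- exact: torsion_saturated.
- exact: quot_pi_surj.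
- exact: pi_eq0.
Qed.

(** [F x] determines [x ^+ p] through [redtrans]. So the kernel of [F] is nil, and if [F x = F y]
    with [y] in the torsion image, then [x ^+ p = y ^+ p] lies there too. *)
Lemma red_dim_condS i n : red_dim_cond i.+1 n <-> red_dim_cond i n.
Proof.
have E0 m : has_chain_above [set (0 : redlayer I0 i.+1)] m <->
            has_chain_above [set (0 : redlayer I0 i)] m.
  apply: (has_chain_im (@F_surj i)) => // [_ [_ -> <-]|x Fx].
    exact: rmorph0.
  by exists p; rewrite -(frob_projE p_prime H) Fx rmorph0; apply: ideal0.
have ET m : has_chain_above (red_torsion i.+1) m <-> has_chain_above (red_torsion i) m.
  apply: (has_chain_im (@F_surj i)); first exact: ideal0.
    by move=> _ [x Tx <-]; apply: F_red_torsion.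
  move=> x /F_red_torsion_surj[y Ty Fyx]; exists p; apply: sub_ideal_gen.
  rewrite -(frob_projE p_prime H) -Fyx (frob_projE p_prime H).
  exact: (idealX Ty (prime_gt0 p_prime)).
rewrite /red_dim_cond E0.
by split=> -[|[m nm]]; [left|move/ET; right; exists m|left|move/ET; right; exists m].
Qed.

Lemma has_chain_tilt j n :
  has_chain_above (set0 : set (tilt p_prime H j)) n <-> red_dim_cond j n.
Proof.
have [I1 [[g I1g] I1p kerF]] := pft_kernel hR.
pose gi i : R i.+1 := tower_map (tower_shift R) i g.
have kerFi i x : F i x = 0 <-> exists c, x = c * pi i.+1 (gi i).
  have := kerF i; rewrite I1g.
  have -> : [set quot_pi (ext_I0 I0 i.+1) (tower_map (tower_shift R) i a)
            | a in ideal_gen [set g]] =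
            (pi i.+1 \o tower_map (tower_shift R) i) @` ideal_gen [set g] by [].
  rewrite (ideal_gen_image1 (pi i.+1 \o tower_map (tower_shift R) i)) => kerE.
  split=> [Fx|/ideal_gen1P gx].
    apply/ideal_gen1P.
    by rewrite -[pi _ _]/((pi i.+1 \o tower_map (tower_shift R) i) g) -kerE.
  by have : [set x | frob_proj p_prime (pft_insep hR) i x = 0] x by rewrite kerE.
(* In [R 1], [f] lies in the [p]-th power of [I1 = (g)]; transport along the tower keeps the same
   cofactor [u]. *)
have [u fu] : exists u, forall i,
    fi i.+1 = tower_map (tower_shift R) i u * gi i ^+ p.
  have : ideal_exp I1 p (fi 1).
    by rewrite I1p; apply/ext_I0P; exists 1; rewrite mul1r.
  move=> /(ideal_exp_principal I1g)/ideal_gen1P[u fu]; exists u => i.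
  by rewrite tower_map_shift -[trans R 0 f]/(fi 1) fu rmorphM rmorphXn.
have g_tor i x : pi i.+1 (gi i) * x = 0 -> red_torsion i (F i x).
  have [b <-] := quot_pi_surj x.
  rewrite -rmorphM => /pi_eq0[c gb].
  pose v := tower_map (tower_shift R) i u.
  (* From [g * b = c * f] and [f = v * g ^+ p] follows [g * (b - d) = 0], so [b - d] is torsion. As
     [p] is at least two, [d] is a multiple of [g] and [F] kills its class. *)
  pose d := c * v * gi i ^+ p.-1.
  have Tbd : torsion i.+1 (b - d).
    suff : (b - d) * fi i.+1 = 0 by [].
    rewrite fu -(prednK (prime_gt0 p_prime)) exprS -/v.
    have -> : (b - d) * (v * (gi i * gi i ^+ p.-1)) =
       v * gi i ^+ p.-1 * (gi i * b - gi i * d) by ring.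
    rewrite gb fu -(prednK (prime_gt0 p_prime)) exprS /d -/v /=.
    by ring.
  have -> : F i (quot_pi (ext_I0 I0 i.+1) b) = F i (pi i.+1 (b - d)).
    rewrite rmorphB rmorphB /= (_ : F i (pi i.+1 d) = 0) ?subr0 //.
    apply/kerFi; exists (pi i.+1 (c * v * gi i ^+ p.-2)).
    rewrite -rmorphM -mulrA -exprSr prednK //.
    by rewrite -ltnS prednK ?prime_gt1 ?prime_gt0.
  by apply: F_red_torsion; exists (b - d).
apply: (@has_chain_ring_lim (fun m => redlayer I0 (m + j)) p (fun m => F (m + j))
  (fun m => redtrans I0 (m + j)) (fun m => pi (m + j).+1 (gi (m + j)))
  (fun m => red_torsion (m + j))).
- exact: prime_gt1.
- by move=> m; apply: F_surj.
- by move=> m x; apply: frob_projE.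
- by move=> m x; apply: kerFi.
- by move=> m; rewrite /redtrans /= quot_mapE.
- refine (@noetherian_im (R j) (redlayer I0 j) (pi j) _ (@noethR j)).
  exact: quot_pi_surj.
- by move=> m x; apply: F_red_torsion.
- by move=> m x; apply: F_red_torsion_inj.
- by move=> m x; apply: F_red_torsion_surj.
by move=> m x; apply: g_tor.
Qed.

End PerfectoidTowerDimension.

Theorem corollary3p7 (p : nat) (p_prime : prime p)
    (R : tower) (I0 : ideal (R 0%N)) (hR : perfectoid_tower p_prime I0)
    (hNL : forall i : nat, noetherian (R i) /\ local_ring (R i)) :
  forall i j : nat,
    krull_dim (R i) = krull_dim (R 0%N) /\
    krull_dim (R 0%N) = krull_dim (tilt p_prime (pft_insep hR) j).
Proof.
move=> i j; have noethR k := proj1 (hNL k).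
have [f I0f] := pft_principal hR.
have dim0 k n : red_dim_cond I0 f k n <-> red_dim_cond I0 f 0 n.
  elim: k => [|k IHk]; first by split.
  exact: iff_trans (red_dim_condS hR I0f k n) IHk.
split; apply: krull_dim_eq => n.
  by rewrite !(has_chain_layer hR noethR I0f) dim0.
rewrite (has_chain_layer hR noethR I0f) (has_chain_tilt hR noethR I0f).
by rewrite dim0.
Qed.
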